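(* For every integer $k\geq 3$ and every real $\mu\in(0,\frac{k-1}{k})$ there is a set of natural numbers $X\subseteq\mathbb{N}$ such that (i) for every $r\geq 1$, every colouring of $X$ with $r$ colours contains a monochromatic arithmetic progression of length $k$, and (ii) every finite subset $Y\subseteq X$ contains a subset $Z\subseteq Y$ of size $|Z|\geq\mu|Y|$ that contains no arithmetic progression of length $k$.
   Context: An arithmetic progression of length $k$ is a set $\{a, a+d, a+2d,\dots,a+(k-1)d\}$ of integers with $d$ a positive integer (so it consists of $k$ distinct numbers). *)

(* Defs.v *)
From Stdlib Require Export Reals List Arith.
Export ListNotations.
Open Scope R_scope.

Definition contains_AP (k : nat) (S : nat -> Prop) : Prop :=
  exists a d : nat, (0 < d)%nat /\ forall i : nat, (i < k)%nat -> S (a + i * d)%nat.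

Definition is_colouring (r : nat) (X : nat -> Prop) (c : nat -> nat) : Prop :=
  forall x, X x -> (c x < r)%nat.

Definition has_mono_AP (k : nat) (X : nat -> Prop) (c : nat -> nat) : Prop :=
  exists col : nat, contains_AP k (fun x => X x /\ c x = col).

Definition finite_subset (Y : list nat) (X : nat -> Prop) : Prop :=
  NoDup Y /\ forall y, In y Y -> X y.

(* Main.v *)
Require Import Defs.
From Stdlib Require Import Reals List Arith Lra.
From mathcomp Require all_boot all_algebra boolp zify ring.
Open Scope R_scope.

(** A random set containing every vertex of a hypergraph with probability at least [mu] and containing
    no edge pulls back along homomorphisms, and averaging turns it into property (ii). Hence it suffices
    to find a finite hypergraph [G] of large chromatic number that has such random sets, and a finite set
    of integers that is still Ramsey for progressions of length [k] and all of whose progressions of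
    length [k] are mapped to edges of [G].

    For [G] take increasing [m]-tuples, with [k] consecutive windows of a longer tuple as edges. Mark the
    entries sparsely at random: the position of the first marked entry drops by one when the window is
    shifted, so discarding the tuples for which it is marginal or lies in a random residue class modulo
    [k] destroys all edges and costs little more than a proportion of [1/k]. By van der Waerden's theorem
    every vertex may in addition carry an integer height that runs through a progression along each edge.

    The integers are built by the partite construction: start with disjoint progressions, one for each
    edge, and treat the vertices [v] of [G] one after the other. The Hales-Jewett theorem on the fibre
    over [v], with words read as digit expansions in a large base, yields a copy of the current set whose
    fibre over [v] is monochromatic. The height is kept as an additional digit, which excludes unwanted
    progressions. Finally, the sets obtained for the various numbers of colours are placed far apart. *)

(* Confines the MathComp notations, which would change the meaning of the theorem. *)
Module PartiteConstruction.
Import all_boot all_algebra boolp zify ring.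
Import GRing.Theory Num.Theory.
Set Implicit Arguments.
Unset Strict Implicit.
Unset Printing Implicit Defensive.
Local Open Scope nat_scope.

(** * The Hales-Jewett theorem and monotone paths *)

Section HalesJewett.
Variable T : finType.

(** A combinatorial line is a word over [option T]; [None] marks the active coordinates, into which
    the moving letter is substituted. *)
Definition line_pt (I : finType) (w : {ffun I -> option T}) (a : T) : {ffun I -> T} :=
  [ffun i => odflt a (w i)].

Definition is_line (I : finType) (w : {ffun I -> option T}) : Prop :=
  exists i, w i = None.

(** Words use all letters of [T], but lines are monochromatic only on the letters in [s]; so the
    alphabet grows by induction inside one fixed type. *)
Definition HJ (s : seq T) : Prop :=
  forall K : finType, exists I : finType, forall C : {ffun I -> T} -> K,
  exists w : {ffun I -> option T}, is_line w /\
    {in s &, forall a b, C (line_pt w a) = C (line_pt w b)}.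

(* Colour focusing; [a0] is the letter to be added to the alphabet [s]. *)
Definition focused (I : finType) (K : finType) (C : {ffun I -> T} -> K)
    (s : seq T) (a0 : T) (p : {ffun I -> T}) (S : {set K}) : Prop :=
  forall col, col \in S -> exists w : {ffun I -> option T},
    [/\ is_line w, line_pt w a0 = p & {in s, forall b, C (line_pt w b) = col}].

Definition fjoin (X : Type) (I J : finType) (u : {ffun I -> X}) (v : {ffun J -> X}) :
    {ffun (I + J)%type -> X} :=
  [ffun z => match z with inl i => u i | inr j => v j end].

Lemma line_pt_join (I J : finType) (u : {ffun I -> option T}) (v : {ffun J -> option T}) a :
  line_pt (fjoin u v) a = fjoin (line_pt u a) (line_pt v a).
Proof. by apply/ffunP => -[i|j]; rewrite !ffunE. Qed.

Lemma line_pt_const (I : finType) (p : {ffun I -> T}) a :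
  line_pt [ffun i => Some (p i)] a = p.
Proof. by apply/ffunP => i; rewrite !ffunE. Qed.

(** Induction on [n]: new coordinates are put in front of the old ones, and then either a line is
    completed or one more colour becomes focused. *)
Lemma HJ_focus (s : seq T) (a0 b0 : T) (K : finType) : b0 \in s -> HJ s ->
  forall n, n <= #|K| -> exists I : finType, forall C : {ffun I -> T} -> K,
    (exists w : {ffun I -> option T}, is_line w /\
      {in a0 :: s &, forall a b, C (line_pt w a) = C (line_pt w b)}) \/
    (exists p (S : {set K}), #|S| = n /\ focused C s a0 p S).
Proof.
move=> b0s hj; elim=> [|n IHn] ltnK.
  exists unit => C; right; exists [ffun => a0], set0.
  by split; [rewrite cards0 | move=> col; rewrite inE].
have [J focJ] := IHn (ltnW ltnK).
have [I HI] := hj {ffun {ffun J -> T} -> K}.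
exists (I + J)%type => C.
(* The colour of a prefix [u] is the whole colouring of suffixes that it induces, so the letters of
   [s] on [w] become interchangeable in front of every suffix. *)
have [w [[i0 wi0] wP]] := HI (fun u => [ffun v => C (fjoin u v)]).
have {}wP : {in s, forall b v, C (fjoin (line_pt w b) v) = C (fjoin (line_pt w b0) v)}.
  by move=> b bs v; have /ffunP/(_ v) := wP b b0 bs b0s; rewrite !ffunE.
case: (focJ (fun v => C (fjoin (line_pt w b0) v))) => [[l [[j0 lj0] lP]]|[p [S [cardS focS]]]].
  left; exists (fjoin [ffun i => Some (line_pt w b0 i)] l); split.
    by exists (inr j0); rewrite ffunE.
  by move=> a b ha hb; rewrite !line_pt_join !line_pt_const; apply: lP.
set q := C (fjoin (line_pt w b0) p).
(* If [q] is already focused, its line extends to [a0]. Otherwise [w] followed by the constant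
   suffix [p] is a line of the new colour [q], and the old lines are prefixed with [w]. *)
case: (boolP (q \in S)) => qS.
  have [l [[j0 lj0] lp lP]] := focS _ qS.
  left; exists (fjoin [ffun i => Some (line_pt w b0 i)] l); split.
    by exists (inr j0); rewrite ffunE.
  suff E : {in a0 :: s, forall a, C (fjoin (line_pt w b0) (line_pt l a)) = q}.
    by move=> a b ha hb; rewrite !line_pt_join !line_pt_const !E.
  move=> a; rewrite inE => /orP [/eqP ->|/lP //].
  by rewrite lp.
right; exists (fjoin (line_pt w a0) p), (q |: S); split.
  by rewrite cardsU1 qS cardS.
move=> col; rewrite !inE => /orP [/eqP -> |/focS [l [[j0 lj0] lp lP]]].
  exists (fjoin w [ffun j => Some (p j)]); split.
  - by exists (inl i0); rewrite ffunE.
  - by rewrite line_pt_join line_pt_const.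
  - by move=> b bs; rewrite line_pt_join line_pt_const wP.
exists (fjoin w l); split.
- by exists (inl i0); rewrite ffunE.
- by rewrite line_pt_join lp.
- by move=> b bs; rewrite line_pt_join wP // lP.
Qed.

(** Once all colours are focused, the colour of the focus itself is among them, and the
    corresponding line is monochromatic including [a0]. *)
Lemma HJ_cons (s : seq T) (a0 : T) : HJ s -> HJ (a0 :: s).
Proof.
case: s => [_ K|b0 s hj K].
  exists unit => C; exists [ffun => None]; split; first by exists tt; rewrite ffunE.
  by move=> a b; rewrite !inE => /eqP -> /eqP ->.
have [I HI] := HJ_focus a0 (mem_head b0 s) hj (leqnn #|K|).
exists I => C; case: (HI C) => // -[p [S [cardS focS]]].
have /focS [w [wl wp wP]] : C p \in S.
  have -> : S = setT by apply/eqP; rewrite eqEcard subsetT cardsT cardS leqnn.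
  by rewrite inE.
exists w; split=> //.
suff E : {in a0 :: b0 :: s, forall a, C (line_pt w a) = C p} by move=> a b ha hb; rewrite !E.
by move=> a; rewrite inE => /orP [/eqP ->|/wP //]; rewrite wp.
Qed.

Theorem Hales_Jewett (K : finType) : exists I : finType, forall C : {ffun I -> T} -> K,
  exists w : {ffun I -> option T}, is_line w /\
    forall a b, C (line_pt w a) = C (line_pt w b).
Proof.
have hj s : HJ s.
  elim: s => [|a s IH]; last exact: HJ_cons.
  move=> L; exists unit => C; exists [ffun => None]; split=> //.
  by exists tt; rewrite ffunE.
have [I HI] := hj (enum T) K.
exists I => C; have [w [wl wP]] := HI C.
by exists w; split=> // a b; apply: wP; rewrite mem_enum.
Qed.

End HalesJewett.

(** Adding up the letters of a word turns a line into a progression whose difference is the number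
    of active coordinates. *)
Lemma van_der_Waerden (k : nat) (K : finType) : exists N : nat, forall c : nat -> K,
  exists a d, [/\ 0 < d, forall j, j < k -> a + j * d < N &
                  forall j, j < k -> c (a + j * d) = c a].
Proof.
case: k => [|k]; first by exists 0 => c; exists 0, 1; split.
have [I HI] := Hales_Jewett 'I_k.+1 K.
exists (#|I| * k).+1 => c.
have [w [[i0 wi0] wP]] := HI (fun u : {ffun I -> 'I_k.+1} => c (\sum_i u i)).
pose a := \sum_i line_pt w ord0 i; pose d := #|[pred i | w i == None]|.
have E (j : 'I_k.+1) : \sum_i line_pt w j i = a + j * d.
  rewrite /a /d -sum1_card big_distrr /= [X in _ + X]big_mkcond /= -big_split /=.
  apply: eq_bigr => i _; rewrite !ffunE inE.
  by case: (w i) => [x|] /=; rewrite ?addn0 ?muln1.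
exists a, d; split.
- by apply/card_gt0P; exists i0; rewrite inE wi0.
- move=> j ltj; rewrite -(E (Ordinal ltj)) ltnS -sum_nat_const.
  by apply: leq_sum => i _; rewrite -ltnS ltn_ord.
- move=> j ltj; rewrite -(E (Ordinal ltj)) (wP _ ord0).
  by rewrite E mul0n addn0.
Qed.

Lemma monotone_path2_base (K : finType) : exists N : nat, forall c : seq nat -> K,
  exists y, [/\ sorted ltn y, all (gtn N) y, size y = 2 &
    c (take 1 (drop 1 y)) = c (take 1 y)].
Proof.
exists #|K|.+1 => c.
pose g (i : 'I_#|K|.+1) := c [:: nat_of_ord i].
have : ~~ injectiveb g.
  apply/injectiveP => /leq_card; rewrite card_ord; lia.
case/injectivePn => i [j neq_ij eq_g].
have ltij : nat_of_ord i <> j by move/val_inj => eqij; rewrite eqij eqxx in neq_ij.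
have hi := ltn_ord i; have hj := ltn_ord j.
rewrite /g in eq_g.
case: (ltngtP i j) => // h; [exists [:: nat_of_ord i; nat_of_ord j]|exists [:: nat_of_ord j; nat_of_ord i]].
all: by split=> //=; rewrite ?h ?hi ?hj.
Qed.

(* The auxiliary colour of an [m]-tuple [x] records which monochromatic paths of windows start at [x];
   if two consecutive tuples get the same auxiliary colour, such paths can be prolonged for ever. *)
Lemma monotone_path_step (m : nat) :
  (forall K : finType, exists N : nat, forall c : seq nat -> K,
    exists y, [/\ sorted ltn y, all (gtn N) y, size y = m.+2 &
      c (take m.+1 (drop 1 y)) = c (take m.+1 y)]) ->
  forall (k : nat) (K : finType), exists N : nat, forall c : seq nat -> K,
    exists y, [/\ sorted ltn y, all (gtn N) y, size y = m.+1 + k &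
      exists col, forall j, j < k -> c (take m.+2 (drop j y)) = col].
Proof.
move=> H2 k K; have [N HN] := H2 {set 'I_k.+1 * K}.
exists N => c.
pose path_from (l : nat) (col : K) x := exists y,
  [/\ sorted ltn y, all (gtn N) y, size y = m.+1 + l, take m.+1 y = x &
     forall j, j < l -> c (take m.+2 (drop j y)) = col].
have [z [zs zN sz]] := HN (fun x => [set p | `[< path_from (nat_of_ord p.1) p.2 x >]]).
case: z zs zN sz => [//|z0 z] zs zN [sz]; rewrite /= drop0 => /setP eqS.
have take_z : take m.+1 z = z by rewrite take_oversize // sz.
rewrite take_z in eqS.
have zs' : sorted ltn z by apply: path_sorted zs.
have zN' : all (gtn N) z by case/andP: zN.
pose col := c (z0 :: z).
suff H l : l <= k -> path_from l col z.
  by have [y [ys yN sy _ yc]] := H k (leqnn k); exists y; split=> //; exists col.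
elim: l => [_|l IHl ltlk]; first by exists z; split=> //; rewrite sz addn0.
have [y [ys yN sy ty yc]] := IHl (ltnW ltlk).
(* Equal auxiliary colours reduce the goal to the window starting with [z0]; prepending [z0] to [y]
   adds the window [z0 :: z], of colour [col]. *)
have := eqS (Ordinal (ltlk : l.+1 < k.+1), col); rewrite !inE /= => eqb.
apply/asboolP; rewrite eqb; apply/asboolP.
exists (z0 :: y); split.
- move: zs ys ty; case: (y) sy => [|y0 y'] //= _; case: (z) => [|z1 z'] //= /andP [h _] -> [-> _].
  by rewrite h.
- by rewrite /= yN andbT; case/andP: zN.
- by rewrite /= sy addnS.
- by rewrite /= -ty take_takel.
- case=> [_|j /yc //=]; by rewrite /= ty.
Qed.

(** The step with two windows yields its own hypothesis for the next window length. *)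
Lemma monotone_path (m k : nat) (K : finType) : exists N : nat, forall c : seq nat -> K,
  exists y, [/\ sorted ltn y, all (gtn N) y, size y = m.+1 + k &
    exists col, forall j, j < k -> c (take m.+2 (drop j y)) = col].
Proof.
apply: monotone_path_step; elim: m => [|m IH] L; first exact: monotone_path2_base.
have [N HN] := monotone_path_step IH 2 L.
exists N => c; have [y [ys yN sy [col yc]]] := HN c.
exists y; split=> //; first by rewrite sy addn2.
by have := yc 0 isT; rewrite (yc 1) // drop0 => ->.
Qed.

(** * A hypergraph of large chromatic and small fractional chromatic number *)

Lemma card_ffun_constrained (D R : finType) (S : {set D}) (A : {set R}) :
  #|[set w : {ffun D -> R} | [forall n in S, w n \in A]]| = #|A| ^ #|S| * #|R| ^ (#|D| - #|S|).
Proof.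
pose F n : pred R := if n \in S then [in A] else predT.
have -> : #|[set w : {ffun D -> R} | [forall n in S, w n \in A]]| = #|family F|.
  apply: eq_card => w; rewrite inE; apply/forall_inP/familyP => h n.
    by rewrite /F; case: ifP => // /h.
  by move=> nS; have := h n; rewrite /F nS.
rewrite card_family foldrE big_map big_enum /=.
rewrite (bigID [in S]) /= (eq_bigr (fun=> #|A|)); last by move=> n nS; rewrite /F nS.
rewrite [X in _ * X](eq_bigr (fun=> #|R|)); last by move=> n /negbTE nS; rewrite /F nS.
rewrite !prod_nat_const; congr (_ * _ ^ _).
by rewrite -(cardsC S) addKn; apply: eq_card => n; rewrite !inE.
Qed.

(** Bernoulli's inequality; it will make it unlikely that a long tuple has no marked entry. *)
Lemma pow_ratio_unbounded (Q B : nat) : exists m, B * Q ^ m <= Q.+1 ^ m.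
Proof.
case: Q => [|Q]; first by exists 1; rewrite expn1 muln0.
exists (B * Q.+1).
have H n : Q.+1 ^ n * (Q.+1 + n) <= Q.+2 ^ n * Q.+1.
  elim: n => [|n IH]; first by rewrite !expn0; lia.
  rewrite !expnS; nia.
have := H (B * Q.+1); set x := _ ^ _; set y := _ ^ _; nia.
Qed.

Section RandomPosition.
Variables (k m N Q : nat).
Implicit Types (w : {ffun 'I_N -> 'I_Q.+1}) (x : {ffun 'I_m -> 'I_N}).

(** An integer is marked when [w] vanishes there; under uniform [w] this has probability [1/(Q+1)],
    independently for distinct integers. *)
Definition first_zero w x (p : 'I_m) : bool :=
  (w (x p) == ord0) && [forall i : 'I_m, (i < p) ==> (w (x i) != ord0)].

Definition central (p : 'I_m) : bool := (k.-1 <= p) && (p < m - k.-1).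

Definition selected (ws : {ffun 'I_N -> 'I_Q.+1} * 'I_k) x : bool :=
  [exists p, [&& central p, first_zero ws.1 x p & ~~ (k %| p + ws.2)]].

(** Union bound: a failing [w] marks one of the first [k - 1] entries or none of the first
    [m - (k - 1)]. *)
Lemma card_no_central_zero x : injective x -> k.-1 <= m ->
  #|[set w : {ffun 'I_N -> 'I_Q.+1} | ~~ [exists p, central p && first_zero w x p]]|
    <= k.-1 * Q.+1 ^ (N - 1) + Q ^ (m - k.-1) * Q.+1 ^ (N - (m - k.-1)).
Proof.
move=> injx lekm.
pose B i := [set w : {ffun 'I_N -> 'I_Q.+1} | [forall n in [set x i], w n \in [set ord0]]].
pose S := x @: [set i : 'I_m | i < m - k.-1].
pose C := [set w : {ffun 'I_N -> 'I_Q.+1} | [forall n in S, w n \in [set~ ord0]]].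
have cardS : #|S| = m - k.-1.
  rewrite card_imset // -sum1_card.
  under eq_bigl do rewrite inE.
  by rewrite (big_ord_narrow (leq_subr k.-1 m)) sum_nat_const card_ord muln1.
have cardC : #|C| = Q ^ (m - k.-1) * Q.+1 ^ (N - (m - k.-1)).
  by rewrite card_ffun_constrained cardS !card_ord cardsC1 card_ord.
have cardB i : #|B i| = Q.+1 ^ (N - 1).
  by rewrite card_ffun_constrained !cards1 !card_ord exp1n mul1n.
rewrite -cardC.
apply: leq_trans (_ : #|(\bigcup_(i : 'I_m | i < k.-1) B i) :|: C| <= _); last first.
  rewrite cardsU; apply: leq_trans (leq_subr _ _) _; rewrite leq_add2r.
  apply: leq_trans (_ : \sum_(i < m | i < k.-1) #|B i| <= _).
    elim/big_rec2: _ => [|i a A _ IH]; first by rewrite cards0.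
    by rewrite cardsU; apply: leq_trans (leq_subr _ _) _; rewrite leq_add2l.
  rewrite (big_ord_narrow lekm) /=; under eq_bigr do rewrite cardB.
  by rewrite sum_nat_const card_ord.
apply: subset_leq_card; apply/subsetP => w; rewrite inE => nocz.
rewrite inE; apply/orP.
case: (boolP (w \in C)) => [|nC]; [by right|left].
have [i0 /andP [lti0 wi0]] : exists i : 'I_m, (i < m - k.-1) && (w (x i) == ord0).
  move: nC; rewrite inE => /forall_inPn [n /imsetP [i]]; rewrite inE => lti ->.
  by rewrite !inE negbK => h; exists i; rewrite lti.
pose p := [arg min_(i < i0 | w (x i) == ord0) (nat_of_ord i)].
have [wp minp] : w (x p) == ord0 /\ forall i : 'I_m, w (x i) == ord0 -> p <= i.
  by rewrite /p; case: arg_minnP.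
have fzp : first_zero w x p.
  rewrite /first_zero wp /=; apply/forallP => i; apply/implyP => ltip.
  by apply/negP => /minp; rewrite leqNgt ltip.
apply/bigcupP; exists p.
  rewrite ltnNge; apply: contra nocz => lekp; apply/existsP; exists p.
  by rewrite fzp andbT /central lekp (leq_ltn_trans (minp _ wi0)).
by rewrite inE; apply/forall_inP => n; rewrite !inE => /eqP ->.
Qed.

(** For fixed [w] with a central first zero, at most one of the [k] residue shifts discards the
    tuple. *)
Lemma card_selected x : 0 < k ->
  k.-1 * #|[set w : {ffun 'I_N -> 'I_Q.+1} | [exists p, central p && first_zero w x p]]|
    <= #|[set ws | selected ws x]|.
Proof.
move=> k0; set G := [set w | _].
rewrite mulnC -sum_nat_const -sum1_card (eq_bigl (fun ws => selected ws x)); last by move=> ws; rewrite inE.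
rewrite [X in _ <= X]big_mkcond /= [X in _ <= X](eq_bigr (fun ws => if selected (ws.1, ws.2) x then 1 else 0)); last by case.
rewrite -(pair_bigA _ (fun w s => if selected (w, s) x then 1 else 0)) /=.
rewrite [X in X <= _]big_mkcond /=; apply: leq_sum => w _.
case: ifP => //; rewrite inE => /existsP [p /andP [cp fzp]].
apply: leq_trans (_ : \sum_(s < k | ~~ (k %| p + s)) 1 <= _); last first.
  rewrite big_mkcond /=; apply: leq_sum => s _; case: ifP => // h.
  by rewrite ifT //; apply/existsP; exists p; rewrite cp fzp h.
rewrite sum1_card.
have cardk := cardC [pred s : 'I_k | k %| p + s]; rewrite card_ord in cardk.
have -> : #|[pred s : 'I_k | ~~ (k %| p + s)]| = #|[predC [pred s : 'I_k | k %| p + s]]| by [].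
suff le1 : #|[pred s : 'I_k | k %| p + s]| <= 1.
  by rewrite -[in k.-1]cardk -subn1 leq_subLR leq_add2r.
apply/card_le1_eqP => s t; rewrite !inE => hs ht; apply/val_inj => /=.
have := ltn_ord s; have := ltn_ord t.
move: hs ht; rewrite /dvdn => /eqP hs /eqP ht lt_t lt_s.
have : s == t %[mod k] by rewrite -(eqn_modDl p) hs ht.
by rewrite !modn_small // => /eqP.
Qed.

(* The windows of [y] share their first zero of [w], whose position drops by one at each shift. *)
Lemma windows_not_selected (y : nat -> 'I_N) (ws : {ffun 'I_N -> 'I_Q.+1} * 'I_k) : 0 < k ->
  exists2 j, j < k & ~~ selected ws [ffun i : 'I_m => y (i + j)].
Proof.
move=> k0; apply: contrapT => all_sel.
have {}all_sel j : j < k -> selected ws [ffun i : 'I_m => y (i + j)].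
  by move=> ltj; apply: contrapT => h; apply: all_sel; exists j => //; apply/negP.
have zeros j : j < k -> exists p, [/\ k.-1 <= p, p < m - k.-1, ws.1 (y (p + j)) = ord0,
    forall i, i < p -> ws.1 (y (i + j)) <> ord0 & ~~ (k %| p + ws.2)].
  move=> /all_sel /existsP [p /and3P [/andP [lop hip] /andP [/eqP wp /forallP fp] np]].
  exists p; split=> //; first by rewrite ffunE in wp.
  move=> i ltip; have ltim : i < m by have := ltn_ord p; lia.
  by have := fp (Ordinal ltim); rewrite /= ltip ffunE /= => /eqP.
have [p0 [lo0 hi0 z0 nz0 _]] := zeros 0 k0.
(* In window [j] the common first zero stands at [p0 - j], and this [j] makes [p0 - j + ws.2]
   divisible by [k]. *)
pose j := (p0 + ws.2) %% k.
have ltjk : j < k by rewrite ltn_mod.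
have [p [lo hi z nz]] := zeros j ltjk; case/negP.
have -> : p = p0 - j.
  rewrite addn0 in z0.
  case: (ltngtP p (p0 - j)) => // h.
    by case: (nz0 (p + j)); [lia | rewrite addn0].
  by case: (nz (p0 - j)); [lia | rewrite subnK //; lia].
have -> : p0 - j + ws.2 = p0 + ws.2 - j by lia.
by rewrite -eqn_mod_dvd /j ?modn_mod ?leq_mod.
Qed.

End RandomPosition.

(** [W] is the sample space. The second condition bounds the probability of each vertex below by
    [(k-1)/k - 1/q], cleared of denominators. *)
Lemma high_chromatic_low_fractional (k q : nat) (K : finType) : 2 < k -> 0 < q ->
  exists (V W : finType) (H : V -> nat) (Z : W -> V -> bool),
  [/\ 0 < #|W|,
      forall v, #|W| * (k.-1 * q) <= #|[set w | Z w v]| * (k * q) + #|W| * k &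
      forall c : V -> K, exists (e : nat -> V) (a d : nat),
        [/\ 0 < d, forall j, j < k -> H (e j) = a + j * d,
            forall w, exists2 j, j < k & ~~ Z w (e j) &
            forall j, j < k -> c (e j) = c (e 0)]].
Proof.
move=> k2 q0.
(* Both terms of the union bound become at most [1/(2q)]: the first by this [Q], the second by the
   choice of [m']. *)
pose Q := (2 * k * q).-1.
have QS : Q.+1 = 2 * k * q by rewrite /Q prednK //; nia.
have [m' m'P] := pow_ratio_unbounded Q (2 * q).
pose m := (m' + k - 3).+2.
have mE : m - k.-1 = m' by rewrite /m; lia.
have lekm : k.-1 <= m by rewrite /m; lia.
have [N pathP] := monotone_path (m' + k - 3) k K.
have [h vdwP] := van_der_Waerden k {ffun {ffun 'I_m -> 'I_N.+1} -> K}.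
pose V := ({ffun 'I_m -> 'I_N.+1} * 'I_h.+1)%type.
pose W := ({ffun 'I_N.+1 -> 'I_Q.+1} * 'I_k)%type.
(* Tuples with a repeated entry can lie in every sample set, since edges consist of windows of a
   strictly increasing sequence. *)
exists V, W, (fun v => nat_of_ord v.2), (fun (ws : W) (v : V) => ~~ injectiveb v.1 || selected ws v.1).
split.
- by apply/card_gt0P; exists ([ffun=> ord0], Ordinal (ltnW (ltnW k2))).
- move=> [x y] /=.
  case: (boolP (injectiveb x)) => /= [/injectiveP injx|_]; last first.
    rewrite (_ : [set _ | _] = setT) ?cardsT; last by apply/setP => ws; rewrite !inE.
    by apply: leq_trans (leq_addr _ _); rewrite leq_mul2l leq_mul2r leq_pred !orbT.
  have lemN : m <= N.+1 by have := leq_card x injx; rewrite !card_ord.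
  have := card_selected Q x (ltnW (ltnW k2)).
  have := card_no_central_zero Q injx lekm.
  set G := [set w | [exists _, _]].
  rewrite (_ : [set w | ~~ _] = ~: G); last by apply/setP => w; rewrite !inE.
  have := cardsC G; rewrite card_ffun !card_ord card_prod card_ffun !card_ord mE.
  set g := #|G|; set b := #|~: G|; set z := #|[set _ | _]| => gb b_le z_ge.
  have qb : q * b <= Q.+1 ^ N.+1.
    have E1 : Q.+1 ^ N.+1 = Q.+1 * Q.+1 ^ N by rewrite expnS.
    have E2 : Q.+1 ^ N.+1 = Q.+1 ^ m' * Q.+1 ^ (N.+1 - m').
      by rewrite -expnD subnKC //; lia.
    rewrite subn1 /= in b_le.
    have h1 : 2 * q * (Q ^ m' * Q.+1 ^ (N.+1 - m')) <= Q.+1 ^ N.+1.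
      by rewrite E2 mulnA leq_mul2r m'P orbT.
    have h2 : 2 * q * (k.-1 * Q.+1 ^ N) <= Q.+1 ^ N.+1.
      by rewrite E1 mulnA leq_mul2r QS; apply/orP; right; nia.
    move: b_le h1 h2; set A := Q ^ m' * _; set B := k.-1 * _; set D := _ ^ N.+1.
    nia.
  move: gb z_ge qb; set D := _ ^ N.+1 => <- z_ge qb.
  case: (k) k2 z_ge => [//|k'] _ /= z_ge.
  have : k' * g * (k'.+1 * q) <= z * (k'.+1 * q) by rewrite leq_mul2r z_ge orbT.
  have : k' * k'.+1 * (q * b) <= k' * k'.+1 * (g + b) by rewrite leq_mul2l qb orbT.
  nia.
- move=> c.
  pose tovec (s : seq nat) : {ffun 'I_m -> 'I_N.+1} := [ffun i : 'I_m => inord (nth 0 s i)].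
  (* A height is coloured by the whole colouring of tuples at that height, so along this progression
     the height no longer affects the colour. *)
  have [a [d [d0 ltad eqad]]] :=
    vdwP (fun t => [ffun x : {ffun 'I_m -> 'I_N.+1} => c (x, inord t)]).
  have [y [ys yN sy [col yc]]] := pathP (fun s => c (tovec s, inord a)).
  exists (fun j => (tovec (take m (drop j y)), inord (a + j * d))), a, d; split=> //.
  + by move=> j ltj; rewrite /= inordK //; apply: ltnW; apply: ltad.
  + move=> ws.
    have vecE j : j < k -> tovec (take m (drop j y)) = [ffun i : 'I_m => inord (nth 0 y (i + j))].
      by move=> ltj; apply/ffunP => i; rewrite !ffunE nth_take // nth_drop addnC.
    have [j ltj nsel] := @windows_not_selected k m N.+1 Q (fun i => inord (nth 0 y i)) ws (ltnW (ltnW k2)).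
    exists j => //=; rewrite vecE // negb_or nsel andbT negbK.
    apply/injectiveP => i i'; rewrite !ffunE => eqi.
    have lty (t : 'I_m) : t + j < size y by rewrite sy; have := ltn_ord t; rewrite /m; lia.
    have ltN (t : 'I_m) : nth 0 y (t + j) < N.+1.
      by rewrite ltnS ltnW //; apply: (allP yN); rewrite mem_nth.
    have /eqP := congr1 (@nat_of_ord _) eqi; rewrite !inordK // nth_uniq //.
      by rewrite eqn_add2r => /eqP /val_inj.
    exact: (sorted_uniq ltn_trans ltnn ys).
  + move=> j ltj /=.
    have cE i : i < k -> c (tovec (take m (drop i y)), inord (a + i * d)) = col.
      by move=> lti; have /ffunP/(_ (tovec (take m (drop i y)))) := eqad i lti; rewrite !ffunE => ->; apply: yc.
    by rewrite !cE // (ltnW (ltnW k2)).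
Qed.

(** * The partite construction *)

(** Integer parameters allow differences that are zero or negative: single digits of a progression
    may stand still or decrease. *)
Definition lin (k : nat) (x : nat -> nat) (a d : int) : Prop :=
  forall j, j < k -> ((x j)%:Z = a + d * j%:Z)%R.

Lemma lin_diff2 k x a d j : lin k x a d -> j.+2 < k -> x j + x j.+2 = x j.+1 + x j.+1.
Proof.
move=> xl ltj; have := xl j (ltnW (ltnW ltj)); have := xl j.+1 (ltnW ltj); have := xl _ ltj.
rewrite (_ : j.+2%:Z = j%:Z + 2)%R; last by lia.
rewrite (_ : j.+1%:Z = j%:Z + 1)%R; last by lia.
rewrite !mulrDr; lia.
Qed.

(** Vanishing second differences, written with sums only, are the form in which progressions pass
    between numbers and their digits. *)
Lemma diff2_lin k x : (forall j, j.+2 < k -> x j + x j.+2 = x j.+1 + x j.+1) ->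
  exists a d, lin k x a d.
Proof.
move=> xd; exists (x 0)%:Z%R, ((x 1)%:Z - (x 0)%:Z)%R => j; move: (ltnSn j).
move: {2}j.+1 => n; elim: n j => // n IH [|[|j]] ltjn ltjk; [by rewrite mulr0 addr0|by rewrite mulr1 addrC subrK|].
have := IH j.+1 ltjn (ltnW ltjk); have := IH j (ltnW ltjn) (ltnW (ltnW ltjk)).
have := xd j ltjk.
rewrite (_ : j.+2%:Z = j%:Z + 2)%R; last by lia.
rewrite (_ : j.+1%:Z = j%:Z + 1)%R; last by lia.
rewrite !mulrDr; lia.
Qed.

Lemma lin_eq2 k x y a d a' d' i j : lin k x a d -> lin k y a' d' -> i < k -> j < k ->
  i <> j -> x i = y i -> x j = y j -> a = a' /\ d = d'.
Proof.
move=> xl yl lti ltj nij ei ej.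
have hi : (a + d * i%:Z = a' + d' * i%:Z)%R by rewrite -xl // -yl // ei.
have hj : (a + d * j%:Z = a' + d' * j%:Z)%R by rewrite -xl // -yl // ej.
have : ((d - d') * (i%:Z - j%:Z) == 0)%R.
  rewrite (_ : (_ * _)%R = ((a + d * i%:Z - (a' + d' * i%:Z)) - (a + d * j%:Z - (a' + d' * j%:Z)))%R);
    last by ring.
  by rewrite hi hj !subrr.
rewrite mulf_eq0 => /orP [/eqP h|/eqP h]; last by lia.
have dd : d = d' by apply/eqP; rewrite -subr_eq0 h.
by split=> //; move: hi; rewrite dd => /addIr.
Qed.

Lemma lin_inj k x a d i j : lin k x a d -> d <> 0%R -> i < k -> j < k -> x i = x j -> i = j.
Proof.
move=> xl d0 lti ltj eij; apply: contrapT => nij; apply: d0.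
have yl : lin k (fun=> x i) (x i)%:Z%R 0%R by move=> n _; rewrite mul0r addr0.
by have [] := lin_eq2 xl yl lti ltj nij erefl (esym eij).
Qed.

Section Digits.
Variables (T : eqType) (M : nat).

Definition encode (l : seq T) (f : T -> nat) : nat := foldr (fun z acc => f z + M * acc) 0 l.

Lemma encodeD l f g : encode l (fun z => f z + g z) = encode l f + encode l g.
Proof. by elim: l => //= z l ->; lia. Qed.

Lemma encode_inj l f g : (forall z, z \in l -> f z < M /\ g z < M) ->
  encode l f = encode l g -> {in l, f =1 g}.
Proof.
elim: l => //= z l IH bnd e.
have [fM gM] := bnd z (mem_head _ _).
have M0 : 0 < M by lia.
have ez : f z = g z.
  have := congr1 (modn^~ M) e.
  have modE a b : (a + M * b) %% M = a %% M by rewrite addnC mulnC modnMDl.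
  by rewrite !modE !modn_small.
have el : encode l f = encode l g.
  by move/eqP: e; rewrite ez eqn_add2l eqn_pmul2l // => /eqP.
move=> y; rewrite inE => /orP [/eqP -> //|]; apply: IH => // t tl.
by apply: bnd; rewrite inE tl orbT.
Qed.

End Digits.

Section Partite.
Variables (k : nat) (k2 : 2 < k) (V K : finType) (H : V -> nat).
Variable E : (nat -> V) -> Prop.
Hypothesis E_ext : forall e e', (forall j, j < k -> e j = e' j) -> E e -> E e'.
Hypothesis E_lin : forall e, E e -> exists a d : int, d <> 0%R /\ lin k (fun j => H (e j)) a d.

(** The pictures of the partite construction: [i] is a point at [pos i] in the fibre over
    [phi i]. *)
Definition sound (I : finType) (pos : I -> nat) (phi : I -> V) : Prop :=
  injective pos /\
  forall (x : nat -> I) (a d : int), d <> 0%R -> lin k (fun j => pos (x j)) a d -> E (fun j => phi (x j)).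

(** [T] lists the vertices still to be treated, on whose fibres colourings are assumed constant;
    [[::]] admits all colourings. *)
Definition ramsey_over (T : seq V) (I : finType) (pos : I -> nat) (phi : I -> V) : Prop :=
  forall c : I -> K, (forall i i', phi i = phi i' -> phi i \in T -> c i = c i') ->
  exists (x : nat -> I) (a d : int),
    [/\ d <> 0%R, lin k (fun j => pos (x j)) a d & forall j, j < k -> c (x j) = c (x 0)].

Section Amalgam.
Variables (I : finType) (pos : I -> nat) (phi : I -> V) (v : V) (J : finType).

(** All words over the fibre of [v] qualify; a word leaving the fibre does so with a single letter,
    as happens when a point outside is substituted into a line of the fibre. *)
Definition coherent (u : {ffun J -> I}) : bool :=
  [forall i, forall i', (phi (u i) != v) ==> (phi (u i') != v) ==> (u i == u i')].

Definition power := {u : {ffun J -> I} | coherent u}.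

Definition power_phi (u : power) : V :=
  if [pick i | phi (val u i) != v] is Some i then phi (val u i) else v.

Definition digit (u : power) (z : option J) : nat :=
  if z is Some i then pos (val u i) else H (power_phi u).

(** The factor two keeps sums of two digits below the base, so second differences are compared
    without carries. *)
Definition base : nat := 2 * (\max_i pos i + \max_w H w).+1.

Definition power_pos (u : power) : nat := encode base (enum {: option J}) (digit u).

Lemma power_coherent (u : power) i i' : phi (val u i) <> v -> phi (val u i') <> v ->
  val u i = val u i'.
Proof.
move=> /eqP h /eqP h'; have /forallP/(_ i)/forallP/(_ i') := valP u.
by rewrite h h' => /eqP.
Qed.

Lemma power_phi_out (u : power) i : phi (val u i) <> v -> power_phi u = phi (val u i).
Proof.
move=> h; rewrite /power_phi; case: pickP => [i' /eqP h'|/(_ i)/eqP //].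
by rewrite (power_coherent h h').
Qed.

Lemma power_phi_neq (u : power) : power_phi u <> v -> exists i, phi (val u i) <> v.
Proof. by rewrite /power_phi; case: pickP => // i /eqP h _; exists i. Qed.

Lemma power_phi_in (u : power) : (forall i, phi (val u i) = v) -> power_phi u = v.
Proof. by move=> h; apply: contrapT => /power_phi_neq [i]. Qed.

Lemma digit_bound (u : power) z : 2 * digit u z < base.
Proof.
rewrite /base /digit; case: z => [i|].
  have := leq_bigmax (F := pos) (val u i); lia.
have := leq_bigmax (F := H) (power_phi u); lia.
Qed.

Lemma power_pos_inj : injective pos -> injective power_pos.
Proof.
move=> pinj u u' e; apply/val_inj/ffunP => i; apply: pinj.
suff /(_ (Some i)) : {in enum {: option J}, digit u =1 digit u'} by rewrite mem_enum; apply.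
apply: encode_inj e => z _.
by have := digit_bound u z; have := digit_bound u' z; lia.
Qed.

Lemma digits_lin (x : nat -> power) a d z : lin k (fun j => power_pos (x j)) a d ->
  exists a' d', lin k (fun j => digit (x j) z) a' d'.
Proof.
move=> xl; apply: diff2_lin => j ltj.
have := lin_diff2 xl ltj; rewrite -!encodeD => e.
have {}e := encode_inj _ e; move: z; suff bnd t : t \in enum {: option J} ->
    digit (x j) t + digit (x j.+2) t < base /\ digit (x j.+1) t + digit (x j.+1) t < base.
  by move=> z; apply: (e bnd); rewrite mem_enum.
move=> _; have := digit_bound (x j) t; have := digit_bound (x j.+1) t; have := digit_bound (x j.+2) t; lia.
Qed.

Lemma lin_digits (x : nat -> power) : (forall z, exists a d, lin k (fun j => digit (x j) z) a d) ->
  exists a d, lin k (fun j => power_pos (x j)) a d.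
Proof.
move=> xl; apply: diff2_lin => j ltj; rewrite -!encodeD.
rewrite /encode; elim: (enum _) => //= z l ->.
by have [a [d /lin_diff2/(_ ltj) ->]] := xl z.
Qed.

Lemma third_index (j0 j1 : nat) : exists j, [/\ j < k, j <> j0 & j <> j1].
Proof.
case: (eqVneq 0 j0) => [<-|/eqP n0]; case: (eqVneq 1 j1) => [<-|/eqP n1].
- by exists 2.
- by exists 1; split=> //; lia.
- case: (eqVneq 2 j0) => [<-|/eqP n2]; first by exists 0; split=> //; lia.
  by exists 2; split=> //; lia.
- case: (eqVneq 0 j1) => [<-|/eqP n3]; last by exists 0; split=> //; lia.
  case: (eqVneq 1 j0) => [<-|/eqP n2]; first by exists 2; split=> //; lia.
  by exists 1; split=> //; lia.
Qed.

(* An edge passes through the fibre of [v] at most once, so one moving coordinate [i] already determines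
   all images but one; the height digit rules out that the exceptional point [j0] leaves the fibre. *)
Lemma power_sound : sound pos phi -> sound power_pos power_phi.
Proof.
case=> pinj Pedge; split; first exact: power_pos_inj.
move=> x a d d0 xl.
have k0 : 0 < k by lia.
have k1 : 1 < k by lia.
have xlin i := digits_lin (Some i) xl.
have [ah [dh hl]] := digits_lin None xl; rewrite /= in hl.
have move_edge i a1 d1 : lin k (fun j => pos (val (x j) i)) a1 d1 -> d1 <> 0%R ->
    E (fun j => phi (val (x j) i)) by move=> l1 n1; apply: Pedge n1 l1.
have [i [a1 [d1 [l1 n1]]]] : exists i a1 d1, lin k (fun j => pos (val (x j) i)) a1 d1 /\ d1 <> 0%R.
  apply: contrapT => none; suff e : x 0 = x 1.
    by have := lin_inj xl d0 k0 k1; rewrite e => /(_ erefl).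
  apply/val_inj/ffunP => i; apply: pinj.
  have [a1 [d1 l1]] := xlin i; rewrite /= in l1.
  have d10 : d1 = 0%R by apply: contrapT => h; apply: none; exists i, a1, d1.
  have := l1 0 k0; have := l1 1 k1; rewrite d10 !mul0r !addr0 => <- []; by [].
have Ei := move_edge _ _ _ l1 n1.
have [b [f [f0 fl]]] := E_lin Ei.
(* Without such a [j0], [power_phi] coincides along the progression with the projection of
   coordinate [i]. *)
case: (pselect (exists j0, [/\ j0 < k, phi (val (x j0) i) = v & power_phi (x j0) <> v])); last first.
  move=> none; apply: E_ext Ei => j ltj.
  case: (pselect (phi (val (x j) i) = v)) => [h|h]; last by rewrite (power_phi_out h).
  by rewrite h; apply: contrapT => h'; apply: none; exists j; split=> //; apply/nesym.
case=> j0 [lt0 e0 out0].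
have out j : j < k -> j <> j0 -> phi (val (x j) i) <> v.
  by move=> ltj nj h; apply: nj; apply: (lin_inj fl f0 ltj lt0); rewrite h e0.
(* The height digit agrees with the heights in coordinate [i] at two indices other than [j0], hence
   is the same progression. *)
have heq : lin k (fun j => H (power_phi (x j))) b f.
  have [j1 [lt1 n10 _]] := third_index j0 j0.
  have [j2 [lt2 n20 n21]] := third_index j0 j1.
  have [-> ->] : b = ah /\ f = dh.
    apply: (lin_eq2 fl hl lt1 lt2); first exact: nesym.
      by rewrite (power_phi_out (out _ lt1 n10)).
    by rewrite (power_phi_out (out _ lt2 n20)).
  exact: hl.
have [i' out'] := power_phi_neq out0.
have [a2 [d2 l2]] := xlin i'; rewrite /= in l2.
(* If coordinate [i'] stood still, coherence would give coordinate [i] the same letter at two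
   indices other than [j0], although it moves. *)
have n2 : d2 <> 0%R.
  move=> d20; rewrite d20 in l2.
  have stay j : j < k -> j <> j0 -> val (x j) i = val (x j0) i'.
    move=> ltj nj; have e : val (x j) i' = val (x j0) i'.
      apply: pinj; have := l2 j ltj; have := l2 j0 lt0; rewrite !mul0r !addr0 => <- []; by [].
    by rewrite -e; apply: power_coherent; [apply: out | rewrite e].
  have [j1 [lt1 n10 _]] := third_index j0 j0.
  have [j2 [lt2 n20 n21]] := third_index j0 j1.
  by apply: n21; apply: (lin_inj l1 n1 lt2 lt1); rewrite !stay.
have Ei' := move_edge _ _ _ l2 n2.
case: (pselect (exists j1, j1 < k /\ phi (val (x j1) i') = v)); last first.
  move=> none; apply: E_ext Ei' => j ltj.
  by rewrite (@power_phi_out _ i') // => h; apply: none; exists j.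
(* Now the height of [v] would occur at both [j0] and [j1] in one nonconstant progression. *)
case=> j1 [lt1 e1].
have [b' [f' [f'0 fl']]] := E_lin Ei'.
have n01 : j0 <> j1 by move=> h; apply: out'; rewrite h.
have [j2 [lt2 n20 n21]] := third_index j0 j1.
have out2 : phi (val (x j2) i') <> v.
  by move=> h; apply: n21; apply: (lin_inj fl' f'0 lt2 lt1); rewrite h e1.
have [eb ef] : b' = b /\ f' = f.
  apply: (lin_eq2 (k := k) (y := fun j => H (power_phi (x j))) fl' _ lt0 lt2).
  - exact: heq.
  - exact: nesym.
  - by rewrite (power_phi_out out').
  - by rewrite (power_phi_out out2).
case: n01; apply: (lin_inj fl f0 lt0 lt1) => /=.
by have := fl j1 lt1; rewrite -eb -ef -(fl' j1 lt1) e0 e1 => -[].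
Qed.

End Amalgam.

Lemma amalgamation (v : V) (T : seq V) (I : finType) (pos : I -> nat) (phi : I -> V) :
  sound pos phi -> ramsey_over (v :: T) pos phi ->
  exists (I' : finType) (pos' : I' -> nat) (phi' : I' -> V),
    sound pos' phi' /\ ramsey_over T pos' phi'.
Proof.
move=> snd ram; pose F := {i : I | phi i == v}.
have [J HJ] := Hales_Jewett F K.
exists (power phi v J), (@power_pos I pos phi v J), (@power_phi I phi v J).
split; first exact: power_sound.
move=> c cT.
have cohF (u : {ffun J -> F}) : coherent phi v [ffun i => val (u i)].
  by apply/forallP => i; apply/forallP => i'; rewrite !ffunE (valP (u i)).
have [w [[j0 wj0] wP]] := HJ (fun u => c (Sub _ (cohF u))).
(* The copy of the old picture along [w]: [x] on the active coordinates, the fixed fibre letters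
   elsewhere. Its fibre over [v] consists of the points of the monochromatic line. *)
pose cpf (x : I) : {ffun J -> I} := [ffun i => if w i is Some y then val y else x].
have cpfE x i : phi (cpf x i) <> v -> cpf x i = x.
  by rewrite ffunE; case: (w i) => // y; have /eqP := valP y.
have coh x : coherent phi v (cpf x).
  apply/forallP => i; apply/forallP => i'; apply/implyP => /eqP h; apply/implyP => /eqP h'.
  by rewrite (cpfE _ _ h) (cpfE _ _ h').
pose cp x : power phi v J := Sub (cpf x) (coh x).
have cpj0 x : val (cp x) j0 = x by rewrite /= ffunE wj0.
have cp_phi x : power_phi (cp x) = phi x.
  case: (pselect (phi x = v)) => h; last by rewrite (@power_phi_out _ _ _ _ (cp x) j0) ?cpj0.
  rewrite h; apply: power_phi_in => i /=; rewrite ffunE; case: (w i) => // y; exact/eqP/(valP y).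
case: (ram (fun x => c (cp x))).
  move=> x x' exx'; rewrite inE => /orP [/eqP e|hT]; last first.
    by apply: cT; rewrite !cp_phi.
  have lift y (ey : phi y == v) : cp y = Sub _ (cohF (line_pt w (Sub y ey))).
    apply/val_inj/ffunP => i /=; rewrite !ffunE; by case: (w i).
  have ex : phi x == v by apply/eqP.
  have ex' : phi x' == v by rewrite -exx'.
  by rewrite (lift x ex) (lift x' ex').
move=> x [a [d [d0 xl mono]]].
have [pinj Pedge] := snd.
have [a' [d' xl']] : exists a d, lin k (fun j => power_pos pos (cp (x j))) a d.
  apply: lin_digits => -[i|] /=.
    case wi : (w i) => [y|].
      by exists (pos (val y))%:Z%R, 0%R => j ltj; rewrite ffunE wi mul0r addr0.
    by exists a, d => j ltj; rewrite ffunE wi; apply: xl.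
  have [b [f [_ fl]]] := E_lin (Pedge _ _ _ d0 xl).
  by exists b, f => j ltj; rewrite cp_phi; apply: fl.
exists (fun j => cp (x j)), a', d'; split=> // d'0.
have k0 : 0 < k by lia.
have k1 : 1 < k by lia.
have /(power_pos_inj pinj) e : power_pos pos (cp (x 0)) = power_pos pos (cp (x 1)).
  by have := xl' 0 k0; have := xl' 1 k1; rewrite d'0 !mul0r !addr0 => <- [].
have e01 : x 0 = x 1 by rewrite -(cpj0 (x 0)) e cpj0.
by have := lin_inj xl d0 k0 k1; rewrite e01 => /(_ erefl).
Qed.

Lemma partite_construction (I : finType) (pos : I -> nat) (phi : I -> V) :
  sound pos phi -> ramsey_over (enum V) pos phi ->
  exists (I' : finType) (pos' : I' -> nat) (phi' : I' -> V),
    sound pos' phi' /\ ramsey_over [::] pos' phi'.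
Proof.
elim: (enum V) I pos phi => [|v T IH] I pos phi snd ram; first by exists I, pos, phi.
by have [I' [pos' [phi' [snd' ram']]]] := amalgamation snd ram; apply: IH ram'.
Qed.

End Partite.

(** * Sets of integers *)

Section Blocks.
Variable L : nat -> nat.

(** Doubling the end of the previous block keeps [2 * y], for [y] in an earlier block, below the new
    one; the other summand makes the gap longer than the new block. *)
Fixpoint block_start (s : nat) : nat :=
  if s is s'.+1 then 2 * (block_start s' + L s') + 2 * L s + 1 else 0.

Definition in_block (s n : nat) : bool := block_start s <= n < block_start s + L s.

Lemma block_gap a c : a < c -> 2 * (block_start a + L a) + 2 * L c < block_start c.
Proof.
elim: c => // c IH; rewrite ltnS leq_eqVlt => /orP [/eqP ->|/IH] /=; lia.
Qed.

Lemma in_block_le a b x y : in_block a x -> in_block b y -> x <= y -> a <= b.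
Proof.
rewrite /in_block => ha hb lexy; rewrite leqNgt; apply/negP => /block_gap; lia.
Qed.

Lemma in_block_unique a b n : in_block a n -> in_block b n -> a = b.
Proof.
by move=> ha hb; apply/eqP; rewrite eqn_leq (in_block_le ha hb) // (in_block_le hb ha).
Qed.

(** As [z] is at most [2 * y], it lies in the block of [y]; so the difference is less than the
    length of this block, too small to reach back to an earlier one. *)
Lemma AP3_one_block a b c x y z : x < y -> x + z = 2 * y ->
  in_block a x -> in_block b y -> in_block c z -> a = b /\ b = c.
Proof.
move=> ltxy e ha hb hc.
have leab := in_block_le ha hb (ltnW ltxy).
have lebc : b <= c by apply: (in_block_le hb hc); lia.
have ebc : b = c.
  apply/eqP; rewrite eqn_leq lebc leqNgt; apply/negP => /block_gap.
  by move: hb hc; rewrite /in_block; lia.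
subst c; split=> //; apply/eqP; rewrite eqn_leq leab leqNgt; apply/negP => /block_gap.
by move: ha hb hc; rewrite /in_block; lia.
Qed.

Lemma AP_one_block k A D (b : nat -> nat) : 2 < k -> 0 < D ->
  (forall i, i < k -> in_block (b i) (A + i * D)) -> forall i, i < k -> b i = b 0.
Proof.
move=> k2 D0 hb.
have tri j : j.+2 < k -> b j = b j.+1 /\ b j.+1 = b j.+2.
  move=> ltj; apply: (@AP3_one_block _ _ _ (A + j * D) (A + j.+1 * D) (A + j.+2 * D)); try nia.
  - by apply: hb; lia.
  - by apply: hb; lia.
  - exact: hb.
elim=> // -[_ _|i IH lti]; first by case: (tri 0 k2).
by case: (tri i lti) => _ <-; apply: IH; lia.
Qed.

End Blocks.

Lemma lin_AP k x a d : 0 < k -> d <> 0%R -> lin k x a d -> exists A D, 0 < D /\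
  ((forall i, i < k -> x i = A + i * D) \/ (forall i, i < k -> x (k.-1 - i) = A + i * D)).
Proof.
move=> k0; case: d => [D|D] d0 xl.
  exists (x 0), D; split; first by case: D d0 xl.
  left=> i lti; have := xl i lti; have := xl 0 k0; rewrite mulr0 addr0 => <-; lia.
have ltk : k.-1 < k by lia.
exists (x k.-1), D.+1; split=> //; right=> i lti.
have lt2 : k.-1 - i < k by lia.
have := xl _ lt2; have := xl _ ltk; rewrite NegzE.
rewrite (_ : (k.-1 - i)%:Z = k.-1%:Z - i%:Z)%R; last by lia.
rewrite mulrBr; lia.
Qed.

Section Finite.
Variables (k : nat) (k2 : 2 < k) (V W : finType) (H : V -> nat) (Z : W -> V -> bool).

Definition edge (e : nat -> V) : Prop :=
  (exists a d : int, d <> 0%R /\ lin k (fun j => H (e j)) a d) /\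
  (forall w, exists2 j, j < k & ~~ Z w (e j)).

Lemma edge_ext e e' : (forall j, j < k -> e j = e' j) -> edge e -> edge e'.
Proof.
move=> ee [[a [d [d0 l]]] h]; split.
  by exists a, d; split=> // j ltj; rewrite -ee //; apply: l.
by move=> w; have [j ltj nz] := h w; exists j => //; rewrite -ee.
Qed.

Lemma edge_lin e : edge e -> exists a d : int, d <> 0%R /\ lin k (fun j => H (e j)) a d.
Proof. by case. Qed.

Lemma edge_rev e : edge e -> edge (fun j => e (k.-1 - j)).
Proof.
move=> [[a [d [d0 l]]] h]; split.
  exists (a + d * k.-1%:Z)%R, (- d)%R; split.
    by move/eqP; rewrite oppr_eq0 => /eqP.
  move=> j ltj; rewrite l; last by lia.
  rewrite (_ : (k.-1 - j)%:Z = k.-1%:Z - j%:Z)%R; [by ring|by lia].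
move=> w; have [j ltj nz] := h w; exists (k.-1 - j); first by lia.
by rewrite (_ : k.-1 - (k.-1 - j) = j) //; lia.
Qed.

(** Each colouring of [V] gets its own block of [k] consecutive integers, projecting to an edge that
    is monochromatic under it. *)
Lemma initial_picture (K : finType) (col0 : K) :
  (forall c : V -> K, exists e, edge e /\ forall j, j < k -> c (e j) = c (e 0)) ->
  exists (I : finType) (pos : I -> nat) (phi : I -> V),
    sound k edge pos phi /\ ramsey_over k K (enum V) pos phi.
Proof.
move=> chromatic; have k0 : 0 < k by lia.
have /choice [f fP] : forall c : {ffun V -> K}, exists e,
    edge e /\ forall j, j < k -> c (e j) = c (e 0) by move=> c; apply: chromatic.
pose I := ({ffun V -> K} * 'I_k)%type.
pose st (c : {ffun V -> K}) := block_start (fun=> k) (enum_rank c).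
pose pos (i : I) := st i.1 + i.2.
pose phi (i : I) := f i.1 i.2.
have blk (i : I) : in_block (fun=> k) (enum_rank i.1) (pos i).
  by rewrite /in_block /pos leq_addr ltn_add2l ltn_ord.
exists I, pos, phi; split; first split.
- move=> [c j] [c' j'] e; have := blk (c, j); rewrite e => h.
  have /= ec := in_block_unique h (blk (c', j')).
  have {}ec : c = c' by apply/enum_rank_inj/val_inj.
  move: e; rewrite /pos /= ec => /eqP; rewrite eqn_add2l => /eqP ej.
  by congr pair; apply/val_inj.
- move=> x a d d0 xl.
  have main (g : nat -> I) A D : 0 < D -> (forall i, i < k -> pos (g i) = A + i * D) ->
      edge (fun i => phi (g i)).
    move=> D0 gAP.
    have rk : forall i, i < k -> nat_of_ord (enum_rank (g i).1) = enum_rank (g 0).1.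
      apply: (AP_one_block (L := fun=> k) (A := A) (b := fun i => nat_of_ord (enum_rank (g i).1)) k2 D0).
      by move=> i lti; rewrite -(gAP i lti).
    have gc i : i < k -> (g i).1 = (g 0).1.
      by move=> lti; apply/enum_rank_inj/val_inj/rk.
    have gE i : i < k -> st (g 0).1 + (g i).2 = A + i * D.
      by move=> lti; rewrite -gAP // /pos gc.
    have ltk : k.-1 < k by lia.
    have g2 i : i < k -> (g i).2 = i :> nat.
      move=> lti; have := gE 0 k0; have := gE _ ltk; have := gE i lti.
      have := ltn_ord (g k.-1).2; set u := st _; set p := nat_of_ord _.
      set q := nat_of_ord (g i).2; set t := nat_of_ord (g 0).2 => ltp e1 e2 e3.
      (* All [k] terms lie in one block of [k] integers. *)
      have D1 : D = 1 by nia.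
      by rewrite D1 in e1 e2 e3; lia.
    apply: edge_ext (fP (g 0).1).1 => j ltj.
    by rewrite /phi gc // g2.
  have [A [D [D0 [xAP|xAP]]]] := lin_AP k0 d0 xl; first exact: main xAP.
  apply: edge_ext (edge_rev (main (fun i => x (k.-1 - i)) _ _ D0 xAP)) => j ltj.
  by rewrite (_ : k.-1 - (k.-1 - j) = j) //; lia.
- move=> c cfib.
  (* Being constant on fibres, [c] descends to [V]; [col0] serves the vertices with empty fibre. *)
  pose c' : {ffun V -> K} := [ffun v => if [pick i | phi i == v] is Some i then c i else col0].
  have c'E i : c' (phi i) = c i.
    rewrite ffunE; case: pickP => [i' /eqP h|/(_ i)]; last by rewrite eqxx.
    by apply: cfib; rewrite // mem_enum.
  pose x j : I := (c', Ordinal (ltn_pmod j k0)).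
  exists x, (st c')%:Z%R, 1%R; split=> //.
    by move=> j ltj; rewrite /pos /= modn_small // mul1r PoszD.
  move=> j ltj; rewrite -!c'E /phi /= mod0n modn_small //.
  exact: (fP c').2.
Qed.

End Finite.

Lemma finite_version (k q r : nat) : 2 < k -> 0 < q -> exists X : seq nat,
  (forall c : nat -> nat, (forall x, x \in X -> c x < r.+1) -> exists A D, 0 < D /\
     forall i, i < k -> A + i * D \in X /\ c (A + i * D) = c A) /\
  (forall Y : seq nat, {subset Y <= X} -> exists g : pred nat,
     size Y * (k.-1 * q) <= count g Y * (k * q) + size Y * k /\
     forall A D, 0 < D -> ~ (forall i, i < k -> A + i * D \in X /\ g (A + i * D))).
Proof.
move=> k2 q0.
have [V [W [H [Z [W0 dens chrom]]]]] := high_chromatic_low_fractional 'I_r.+1 k2 q0.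
have k0 : 0 < k by lia.
have chrom' (c : V -> 'I_r.+1) :
    exists e, edge k H Z e /\ forall j, j < k -> c (e j) = c (e 0).
  have [e [a [d [d0 He Ze ce]]]] := chrom c; exists e; split=> //; split=> //.
  exists a%:Z%R, d%:Z%R; split; first by lia.
  by move=> j ltj; rewrite He //; lia.
have [I0 [pos0 [phi0 [snd0 ram0]]]] := initial_picture k2 ord0 chrom'.
have [I [pos [phi [[pinj Pedge] ram]]]] :=
  partite_construction k2 (@edge_ext k V W H Z) (@edge_lin k V W H Z) snd0 ram0.
pose X := [seq pos i | i <- enum I].
have posX i : pos i \in X by apply/mapP; exists i; rewrite ?mem_enum.
exists X; split.
- move=> c cX.
  have [//|x [a [d [d0 xl mono]]]] := ram (fun i => inord (c (pos i))).
  have cmono j : j < k -> c (pos (x j)) = c (pos (x 0)).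
    move=> ltj; have /(congr1 (@nat_of_ord _)) := mono j ltj.
    by rewrite !inordK //; apply: cX.
  have [A [D [D0 xAP]]] := lin_AP k0 d0 xl.
  exists A, D; split=> // i lti.
  have E0 : c A = c (pos (x 0)).
    case: xAP => /(_ 0 k0); rewrite mul0n addn0 => <- //.
    by apply: cmono; lia.
  rewrite E0; case: xAP => /(_ i lti) <-; split; rewrite ?posX //; apply: cmono; lia.
- move=> Y YX.
  (* The pullback of [Z w] along [phi]: progressions in [X] project to edges, and no edge lies
     inside [Z w]. *)
  pose g (w : W) : pred nat := fun n => [exists i, (pos i == n) && Z w (phi i)].
  have gE w i : g w (pos i) = Z w (phi i).
    apply/existsP/idP => [[i' /andP [/eqP /pinj -> //]]|h]; by exists i; rewrite eqxx.
  have gfree w A D : 0 < D -> ~ (forall i, i < k -> A + i * D \in X /\ g w (A + i * D)).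
    move=> D0 h.
    have /choice [x xP] : forall j, exists i, j < k -> pos i = A + j * D.
      move=> j; case: (ltnP j k) => [/h [/mapP [i _ ->] _]|]; first by exists i.
      by case: (h 0 k0) => /mapP [i _ _] _ _; exists i.
    have xl : lin k (fun j => pos (x j)) A%:Z%R D%:Z%R.
      by move=> j ltj; rewrite xP //; lia.
    have [//|_ /(_ w) [j ltj]] := Pedge x _ _ _ xl; first by lia.
    by rewrite -gE xP //; case: (h j ltj) => _ ->.
  suff [w wP] : exists w, size Y * (k.-1 * q) <= count (g w) Y * (k * q) + size Y * k.
    by exists (g w); split=> // A D; apply: gfree.
  (* Averaging: if every [w] fell short, summing over [W] and exchanging the sums would contradict
     [dens]. *)
  apply: contrapT => none.
  have lt w : count (g w) Y * (k * q) + size Y * k < size Y * (k.-1 * q).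
    by rewrite ltnNge; apply/negP => h; apply: none; exists w.
  have cnt : \sum_w count (g w) Y = \sum_(y <- Y) #|[set w | g w y]|.
    under eq_bigr do rewrite -sum1_count big_mkcond.
    rewrite exchange_big /=; apply: eq_bigr => y _.
    by rewrite -big_mkcond /= sum1_card; apply: eq_card => w; rewrite !inE.
  have low : size Y * (#|W| * (k.-1 * q)) <= (\sum_w count (g w) Y) * (k * q) + size Y * (#|W| * k).
    rewrite cnt; elim: Y YX {lt cnt none} => [|y Y IH] YX; first by rewrite mul0n.
    rewrite big_cons /=.
    have /mapP [i _ ei] : y \in X by apply: YX; rewrite mem_head.
    have := dens (phi i).
    rewrite (_ : [set w | Z w (phi i)] = [set w | g w y]); last first.
      by apply/setP => w; rewrite !inE ei gE.
    have /IH : {subset Y <= X} by move=> t tY; apply: YX; rewrite inE tY orbT.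
    rewrite !mulSn mulnDl.
    move: (size Y * (#|W| * (k.-1 * q))) (size Y * (#|W| * k)) (#|W| * (k.-1 * q)) (#|W| * k).
    move: (#|_| * (k * q)) ((\sum_(_ <- _) _) * (k * q)) => *; lia.
  have : \sum_(w : W) (count (g w) Y * (k * q) + size Y * k).+1 <= \sum_(w : W) size Y * (k.-1 * q).
    by apply: leq_sum => w _; apply: lt.
  under eq_bigr do rewrite -addn1.
  rewrite !big_split /= -big_distrl /= !sum_nat_const.
  move: low; move: (\sum_w _) => s low.
  have : size Y * (#|W| * (k.-1 * q)) = #|W| * (size Y * (k.-1 * q)) by ring.
  have : size Y * (#|W| * k) = #|W| * (size Y * k) by ring.
  rewrite muln1 -![#|(fun _ : W => true)|]/(#|W|); lia.
Qed.

Lemma count_partition (T : Type) (J : finType) (p : T -> J) (P : pred T) (s : seq T) :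
  count P s = \sum_j count (fun y => P y && (p y == j)) s.
Proof.
rewrite -sum1_count (partition_big p xpredT) //=.
by apply: eq_bigr => j _; rewrite sum1_count.
Qed.

(** Block [s] carries the finite set for [s.+1] colours. With a common [q] the density bounds add up
    over the blocks, and no progression meets two blocks. *)
Lemma infinite_version (k q : nat) : 2 < k -> 0 < q -> exists X : nat -> Prop,
  (forall r (c : nat -> nat), (forall x, X x -> c x < r.+1) -> exists A D, 0 < D /\
     forall i, i < k -> X (A + i * D) /\ c (A + i * D) = c A) /\
  (forall Y : seq nat, (forall y, y \in Y -> X y) -> exists g : pred nat,
     size Y * (k.-1 * q) <= count g Y * (k * q) + size Y * k /\
     forall A D, 0 < D -> ~ (forall i, i < k -> A + i * D \in Y /\ g (A + i * D))).
Proof.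
move=> k2 q0; have k0 : 0 < k by lia.
have /choice [Xs XsP] := fun r => finite_version r k2 q0.
pose L s := (\max_(x <- Xs s) x).+1.
pose st := block_start L.
pose inX s n := st s <= n /\ n - st s \in Xs s.
have inXblk s n : inX s n -> in_block L s n.
  case=> h1 h2; rewrite /in_block -/st h1 /=.
  have := @leq_bigmax_seq _ _ xpredT id _ h2 isT; rewrite /L /=; move: (\max_(_ <- _) _) h1 => t h1; lia.
have /choice [b bP] : forall n, exists s, (exists s, inX s n) -> inX s n.
  by move=> n; case: (pselect (exists s, inX s n)) => [[s hs]|h]; [exists s | exists 0].
exists (fun n => exists s, inX s n); split.
- move=> r c cX.
  have [ram _] := XsP r.
  have [x xX|A [D [D0 AD]]] := ram (fun x => c (st r + x)).
    by apply: cX; exists r; split; rewrite ?leq_addr // addKn.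
  exists (st r + A), D; split=> // i lti; have [h1 h2] := AD i lti.
  rewrite -addnA; split=> //; exists r; split; rewrite ?leq_addr // addKn //.
- move=> Y YX.
  have bY y : y \in Y -> inX (b y) y by move=> /YX; apply: bP.
  pose R := \max_(y <- Y) b y.
  have ltR y : y \in Y -> b y < R.+1.
    by move=> yY; rewrite ltnS; apply: (@leq_bigmax_seq _ _ xpredT b _ yY).
  pose p y : 'I_R.+1 := inord (b y).
  have pE y j : y \in Y -> (p y == j) = (b y == j).
    by move=> yY; rewrite -(inj_eq val_inj) /= inordK // ltR.
  pose Yb (s : nat) := [seq y - st s | y <- Y & b y == s].
  have /choice [g gP] : forall s, exists g : pred nat,
     size (Yb s) * (k.-1 * q) <= count g (Yb s) * (k * q) + size (Yb s) * k /\
     forall A D, 0 < D -> ~ (forall i, i < k -> A + i * D \in Xs s /\ g (A + i * D)).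
    move=> s; have [_ dens] := XsP s; apply: dens => z /mapP [y].
    by rewrite mem_filter => /andP [/eqP <- /bY [_ h]] ->.
  exists (fun y => g (b y) (y - st (b y))); split.
    rewrite -(count_predT Y) !(count_partition p) /= !big_distrl -big_split /=.
    apply: leq_sum => j _.
    have E1 : count (fun y => p y == j) Y = size (Yb j).
      rewrite size_map size_filter; apply: eq_in_count => y yY /=; exact: pE.
    have E2 : count (fun y => g (b y) (y - st (b y)) && (p y == j)) Y = count (g j) (Yb j).
      rewrite count_map count_filter; apply: eq_in_count => y yY /=.
      by rewrite pE //; case: eqP => [->|]; rewrite ?andbF.
    by rewrite E1 E2; case: (gP j).
  move=> A D D0 h.
  have bc : forall i, i < k -> b (A + i * D) = b A.
    move=> i lti; rewrite -[in RHS](addn0 A) -(mul0n D).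
    apply: (AP_one_block (L := L) (A := A) (b := fun i => b (A + i * D)) k2 D0) => // t ltt.
    by apply: inXblk; apply: bY; case: (h t ltt).
  have [_ free] := gP (b A); apply: (free (A - st (b A)) D D0) => i lti.
  have [hY hg] := h i lti.
  have [leA _] : inX (b A) A by apply: bY; have [] := h 0 k0; rewrite mul0n addn0.
  have [_ hX] := bY _ hY; rewrite bc // in hX hg.
  by rewrite addnC addnBA // addnC.
Qed.

(** * Transfer to lists and real densities *)

Lemma In_mem (x : nat) (s : seq nat) : In x s <-> x \in s.
Proof.
elim: s => //= y s IH; rewrite inE; split.
  by case=> [->|/IH ->]; rewrite ?eqxx ?orbT.
by case/orP => [/eqP ->|/IH]; [left | right].
Qed.

Lemma length_filter (g : pred nat) (s : seq nat) : length (List.filter g s) = count g s.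
Proof. by elim: s => //= y s <-; case: (g y). Qed.

Lemma set_with_density (k q : nat) : (3 <= k)%coq_nat -> (1 <= q)%coq_nat ->
  exists X : nat -> Prop,
    (forall (r : nat) (c : nat -> nat),
       (1 <= r)%coq_nat -> is_colouring r X c -> has_mono_AP k X c) /\
    (forall Y : list nat, finite_subset Y X -> exists Z : list nat,
       [/\ NoDup Z, incl Z Y,
           (length Y * (k.-1 * q) <= length Z * (k * q) + length Y * k)%coq_nat &
           ~ contains_AP k (fun z => In z Z)]).
Proof.
move=> /leP k3 /leP q1; have [X [ram dens]] := infinite_version k3 q1.
exists X; split.
- move=> [|r] c /leP // _ cX.
  have [x Xx|A [D [D0 AD]]] := ram r c; first exact/ltP/cX.
  by exists (c A), A, D; split; [exact/ltP | move=> i /ltP /AD].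
- move=> Y [ndY YX].
  have [y /In_mem /YX //|g [cnt free]] := dens Y.
  exists (List.filter g Y); split.
  + exact: NoDup_filter.
  + by move=> y /filter_In [].
  + by rewrite length_filter; apply/leP.
  + case=> A [D [/ltP D0 AD]]; apply: (free A D D0) => i lti.
    by have /filter_In [/In_mem] := AD i (ltP lti).
Qed.

End PartiteConstruction.

Theorem theorem1p4 :
  forall (k : nat) (mu : R),
    (3 <= k)%nat -> 0 < mu -> mu < INR (k - 1) / INR k ->
    exists X : nat -> Prop,
      (forall (r : nat) (c : nat -> nat),
          (1 <= r)%nat -> is_colouring r X c -> has_mono_AP k X c) /\
      (forall Y : list nat, finite_subset Y X ->
          exists Z : list nat,
            NoDup Z /\ incl Z Y /\ mu * INR (length Y) <= INR (length Z) /\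
            ~ contains_AP k (fun z => In z Z)).
Proof.
  intros k mu hk _ hmu.
  assert (eps_pos : 0 < INR (k - 1) / INR k - mu) by lra.
  (* The loss [1/q] is made smaller than the gap between [mu] and [(k-1)/k]. *)
  destruct (archimed_cor1 _ eps_pos) as [q [hq q_pos]].
  destruct (@PartiteConstruction.set_with_density k q hk q_pos) as [X [ram dens]].
  exists X; split; [exact ram|].
  intros Y hY; destruct (dens Y hY) as [Z [ndZ incZ cardZ freeZ]].
  exists Z; split; [exact ndZ|split; [exact incZ|split; [|exact freeZ]]].
  apply le_INR in cardZ.
  replace (Nat.pred k) with (k - 1)%nat in cardZ by (destruct k; simpl; auto with arith).
  change ssrnat.muln with Nat.mul in cardZ.
  change ssrnat.addn with Nat.add in cardZ.
  rewrite plus_INR, !mult_INR in cardZ.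
  assert (k_pos : 0 < INR k) by (apply lt_0_INR; apply Nat.lt_le_trans with 3%nat; auto with arith).
  assert (q_pos' : 0 < INR q) by (apply lt_0_INR; exact q_pos).
  assert (Y_pos := pos_INR (length Y)).
  assert (dens' : (INR (k - 1) / INR k - / INR q) * INR (length Y) <= INR (length Z)).
  { apply Rmult_le_reg_r with (INR k * INR q); [now apply Rmult_lt_0_compat|].
    replace ((INR (k - 1) / INR k - / INR q) * INR (length Y) * (INR k * INR q))
      with (INR (length Y) * (INR (k - 1) * INR q) - INR (length Y) * INR k)
      by (field; split; lra).
    lra. }
  apply Rle_trans with (2 := dens').
  apply Rmult_le_compat_r; [exact Y_pos|lra].
Qed.
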